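(* Let $T=[t_1,t_2]$ and let $(P_t)_{t\in T}$ with densities $p(\cdot,t)$ with respect to a $\sigma$-finite measure $\nu$ satisfy: $p$ is measurable, $t\mapsto p(x,t)$ is absolutely continuous for $\nu$-a.e. $x$, and the Fisher information $\mathcal{I}(t):=\int_{\mathcal{X}}(\partial_t p(x,t))^2/p(x,t)\,d\nu(x)$ is finite for all $t$ with $\int_T\mathcal{I}<\infty$. Suppose moreover that $\mathcal{I}$ is absolutely continuous on $T$. Let $\mathcal{A}$ be any class of functions $\alpha:T\to\mathbb{R}$ such that (i) $\alpha$ is absolutely continuous on $T$ with weak derivative $\alpha'$ such that $(\alpha')^2$ is absolutely continuous on $T$, and (ii) $\alpha(t_1)=\alpha(t_2)=0$. Then for every measurable $\hat t:\mathcal{X}\to\mathbb{R}$, $$\sup_{t\in T}\mathbb{E}_{P_t}\bigl[(\hat t(\boldsymbol{X})-t)^2\bigr]\;\ge\;\sup_{\alpha\in\mathcal{A}}\left(\frac{\int_T\alpha}{\int_T\sqrt{\mathcal{I}\alpha^2+(\alpha')^2}}\right)^2.$$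
   Context: $\mathbb{E}_{P_t}$ denotes expectation with $\boldsymbol{X}\sim P_t$. Convention: $1/0=0$. *)

(* Defs.v *)
From HB Require Import structures.
From mathcomp Require Import all_boot all_order all_algebra.
From mathcomp Require Import all_classical all_reals all_analysis.
Set Implicit Arguments. Unset Strict Implicit. Unset Printing Implicit Defensive.
Import Order.TTheory GRing.Theory Num.Theory.
Import numFieldNormedType.Exports.
Local Open Scope classical_set_scope.
Local Open Scope ring_scope.

Definition abs_cont (R : realType) (a b : R) (f : R -> R) : Prop :=
  forall e : R, 0 < e -> exists2 d : R, 0 < d &
    forall (n : nat) (s : 'I_n -> R * R),
      (forall i, a <= (s i).1 /\ (s i).1 <= (s i).2 /\ (s i).2 <= b) ->
      (forall i j, i != j -> (s i).2 <= (s j).1 \/ (s j).2 <= (s i).1) ->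
      \sum_(i < n) ((s i).2 - (s i).1) < d ->
      \sum_(i < n) `|f (s i).2 - f (s i).1| < e.

(* Fisher information I(t) = \int (dp(x,t))^2 / p(x,t) dnu(x), where dp is
   (a version of) the partial derivative of p in t.  Convention 1/0 = 0
   is the one of MathComp (x / 0 = 0). *)
Definition fisher (R : realType) (d : measure_display) (X : measurableType d)
  (nu : {measure set X -> \bar R}) (p dp : X -> R -> R) (t : R) : \bar R :=
  (\int[nu]_x (((dp x t) ^+ 2 / p x t)%:E))%E.

(* Main.v *)
Require Import Defs.
From HB Require Import structures.
From mathcomp Require Import all_boot all_order all_algebra.
From mathcomp Require Import all_classical all_reals all_analysis.
From mathcomp Require Import measurable_realfun ring lra.
Import Order.TTheory GRing.Theory Num.Theory.
Import numFieldNormedType.Exports.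
Local Open Scope classical_set_scope.
Local Open Scope ring_scope.

(** For almost every [x] the function [t |-> (that x - t) * alpha t * p x t] is
    absolutely continuous and vanishes at [t1] and [t2], so its derivative
    integrates to [0].  Integrating in [x] and exchanging the integrals gives
    [\int alpha = \int_T \int_X (that - t) (alpha' p + alpha dp)].  At each [t],
    Cauchy-Schwarz in [x] bounds the inner integral by
    [sqrt (E_t (that - t)^2) * sqrt (I alpha^2 + alpha'^2)], where the cross term
    [2 alpha alpha' \int dp] disappears because the score has mean zero for almost
    every [t].  The constant [sqrt (sup_t E_t (that - t)^2)] is then pulled out. *)

(** Two defects of the data are repaired before the main estimate. On an exceptional set [dp] may be
    nonzero where [p] vanishes; [dp ^+ 2 / p] is then 0 by convention and no longer controls [dp],
    so Cauchy-Schwarz would fail. Hence [dp] is reset to 0 at the zeros of [p]. The Fisher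
    information is unchanged, and so is the derivative property, because a nonnegative function can
    only have derivative 0 at an interior zero. Likewise [dalpha] need not be measurable although
    its square is; a measurable function with the same square replaces it. The mean-zero property of
    the score is obtained without differentiating under the integral sign: integrated over any
    [[t1, t]], the mean of the score is a difference of two total masses, both 1, and a function
    whose primitive vanishes identically is 0 almost everywhere. Both exchanges of integrals rest on
    AM-GM bounds such as 2 |dp| <= p + dp^2 / p, whose integral 1 + I(t) is continuous in t. *)

Section abs_cont_theory.
Context {R : realType}.
Implicit Types (a b c : R) (f g F G : R -> R).
Notation mu := (@lebesgue_measure R).

(** * Absolutely continuous functions on a segment *)

Lemma abs_cont_dist {a b f} : abs_cont a b f -> forall e : R, 0 < e ->
  exists2 d : R, 0 < d & forall s t, a <= s <= b -> a <= t <= b ->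
    `|t - s| < d -> `|f t - f s| < e.
Proof.
move=> acf e e0; have [d d0 H] := acf e e0; exists d => // s t sab tab.
wlog st : s t sab tab / s <= t => [W|].
  have [st|/ltW ts] := leP s t; first exact: W.
  by rewrite distrC (distrC (f t)); exact: W.
rewrite ger0_norm ?subr_ge0// => tsd.
have := H 1%N (fun=> (s, t)); rewrite !big_ord1/=; apply => //.
- by move=> _; case/andP: sab => -> _; case/andP: tab => _ ->.
- by move=> i j; rewrite !ord1.
Qed.

Lemma abs_cont_continuous {a b f} : abs_cont a b f ->
  {within `[a, b], continuous f}.
Proof.
move=> acf; apply/subspace_continuousP => x xab.
apply/cvgrPdist_lt => e e0; have [d d0 H] := abs_cont_dist acf _ e0.
rewrite near_withinE; apply/nbhs_ballP; exists d => //= t xt.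
by rewrite in_itv/= => tab; apply: H => //; move: xab; rewrite /= in_itv.
Qed.

Lemma abs_cont_sub {a b c e f} : a <= c -> e <= b ->
  abs_cont a b f -> abs_cont c e f.
Proof.
move=> ac eb acf r r0; have [d d0 H] := acf r r0; exists d => // n s H1 H2.
apply: H => // i; have [? [? ?]] := H1 i; split; first exact: le_trans ac _.
by split => //; exact: le_trans eb.
Qed.

Lemma abs_contD {a b f g} : abs_cont a b f -> abs_cont a b g ->
  abs_cont a b (fun x => f x + g x).
Proof.
move=> acf acg e e0; have e20 : 0 < e / 2 by rewrite divr_gt0.
have [d d0 H] := acf _ e20; have [d' d'0 H'] := acg _ e20.
exists (Num.min d d'); first by rewrite lt_min d0.
move=> n s H1 H2; rewrite lt_min => /andP[H3 H4].
rewrite (splitr e); apply: le_lt_trans (ltrD (H _ _ H1 H2 H3) (H' _ _ H1 H2 H4)).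
rewrite -big_split/=; apply: ler_sum => i _.
by rewrite opprD addrACA; exact: ler_normD.
Qed.

Lemma abs_contN {a b f} : abs_cont a b f -> abs_cont a b (fun x => - f x).
Proof.
move=> acf e e0; have [d d0 H] := acf _ e0; exists d => // n s H1 H2 H3.
by under eq_bigr do rewrite -opprD normrN; exact: H.
Qed.

Lemma abs_cont_bounded {a b f} : abs_cont a b f ->
  exists2 M, 0 < M & forall t, a <= t <= b -> `|f t| <= M.
Proof.
move=> acf; have /compact_bounded := continuous_compact (abs_cont_continuous acf) (@segment_compact _ a b).
move=> [M [_ /(_ (Num.max M 0 + 1))]] H; exists (Num.max M 0 + 1).
  by rewrite ltr_wpDl// le_max lexx orbT.
move=> t tab; apply: H => //=; first by rewrite ltr_pwDr// le_max lexx.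
by exists t => //=; rewrite in_itv.
Qed.

Lemma abs_contM {a b f g} : abs_cont a b f -> abs_cont a b g ->
  abs_cont a b (fun x => f x * g x).
Proof.
move=> acf acg e e0.
have [M M0 fM] := abs_cont_bounded acf; have [N N0 gN] := abs_cont_bounded acg.
have [d d0 H] := acf (e / 2 / N) ltac:(by rewrite !divr_gt0).
have [d' d'0 H'] := acg (e / 2 / M) ltac:(by rewrite !divr_gt0).
exists (Num.min d d'); first by rewrite lt_min d0.
move=> n s H1 H2; rewrite lt_min => /andP[H3 H4].
have {}H := H _ _ H1 H2 H3; have {}H' := H' _ _ H1 H2 H4.
rewrite ltr_pdivlMr// mulr_suml in H; rewrite ltr_pdivlMr// mulr_suml in H'.
rewrite (splitr e); apply: le_lt_trans (ltrD H H').
rewrite -big_split/=; apply: ler_sum => i _.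
have [h1 [h2 h3]] := H1 i.
rewrite [X in `|X|](_ : _ = (f (s i).2 - f (s i).1) * g (s i).1
  + (g (s i).2 - g (s i).1) * f (s i).2); last by ring.
rewrite (le_trans (ler_normD _ _))// !normrM lerD// ler_wpM2l//.
  by apply: gN; rewrite h1/= (le_trans h2).
by apply: fM; rewrite h3 andbT (le_trans h1).
Qed.

Lemma lipschitz_abs_cont {a b f} :
  (forall s t, `|f t - f s| <= `|t - s|) -> abs_cont a b f.
Proof.
move=> H e e0; exists e => // n s H1 H2; apply: le_lt_trans.
apply: ler_sum => i _; have [_ [h _]] := H1 i.
by rewrite (le_trans (H _ _))// ger0_norm// subr_ge0.
Qed.

(** The list runs from right to left, so a family is extended on the right by a single cons. *)
Lemma abs_cont_seq {a b f} : abs_cont a b f -> forall e : R, 0 < e ->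
  exists2 d : R, 0 < d & forall s : seq (R * R),
    (forall i, i \in s -> a <= i.1 /\ i.1 <= i.2 /\ i.2 <= b) ->
    pairwise (fun i j : R * R => j.2 <= i.1) s ->
    \sum_(i <- s) (i.2 - i.1) < d -> \sum_(i <- s) `|f i.2 - f i.1| < e.
Proof.
move=> acf e e0; have [d d0 H] := acf e e0; exists d => // s H1 H2.
rewrite !(big_nth (0,0)) !big_mkord; apply: H => [i|i j ij].
  by apply: H1; exact: mem_nth.
move/(pairwiseP (0, 0)) : H2 => H2.
have [ij'|ji|/val_inj] := ltngtP i j; last by move=> /eqP; rewrite (negbTE ij).
- by right; apply: H2; rewrite ?inE.
- by left; apply: H2; rewrite ?inE.
Qed.

Lemma is_derive0_dist {G : R -> R} {c : R} : is_derive c 1 G 0 ->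
  forall e : R, 0 < e -> exists2 d : R, 0 < d & forall t, `|t - c| < d ->
    `|G t - G c| <= e * `|t - c|.
Proof.
move=> [dG DG0] e e0.
have : h^-1 *: ((G \o shift c) (h *: 1) - G c) @[h --> 0^'] --> 'D_1 G c := dG.
rewrite DG0 => /cvgrPdist_le/(_ _ e0).
rewrite near_withinE => /nbhs_ballP[d d0 H]; exists d => // t tcd.
have [->|tc] := eqVneq t c; first by rewrite !subrr normr0 mulr0.
have tc0 : t - c != 0 by rewrite subr_eq0.
have := H (t - c); rewrite /ball/= sub0r normrN => /(_ tcd tc0).
rewrite sub0r normrN [_ *: 1]mulr1 subrK normrM normfV.
by rewrite ler_pdivrMl ?normr_gt0// mulrC.
Qed.

(* Cousin's argument: the set of [s] for which [G s - G a] is controlled by the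
   increments over finitely many intervals inside [U], up to [e * (s - a)], is
   closed under small steps around every point of [a, b]. *)
Lemma ae_derive0_cst {a b G} (N : set R) : a < b -> abs_cont a b G ->
  mu.-negligible N ->
  (forall t, a <= t <= b -> ~ N t -> is_derive t 1 G 0) -> G b = G a.
Proof.
move=> ab acG [N' [mN' N'0 NN']] DG.
(* One [e] pays for the intervals inside the open set covering [N], by absolute continuity;
   [e * (b - a)] pays for the points with derivative 0. *)
suff H (e : R) : 0 < e -> `|G b - G a| <= e * (1 + (b - a)).
  apply/eqP; rewrite -subr_eq0 -normr_le0; apply/ler_addgt0Pl => e e0.
  have ba0 : 0 < 1 + (b - a) by rewrite ltr_wpDr// subr_ge0 ltW.
  by rewrite addr0 (le_trans (H _ (divr_gt0 e0 ba0)))// divfK// gt_eqF.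
move=> e0; have [d d0 acGd] := abs_cont_seq acG _ e0.
have N'y : (mu N' < +oo)%E by rewrite N'0.
have [U [oU N'U muU]] := lebesgue_regularity_outer mN' N'y d0.
have mU : measurable U by exact: open_measurable.
have {}muU : (mu U < d%:E)%E.
  have UE : (mu U <= mu N' + mu (U `\` N'))%E.
    by rewrite -{1}(setDUK N'U); apply: measureU2 => //; exact: measurableD.
  by apply: le_lt_trans UE _; rewrite N'0 add0e; exact: muU.
(* Lengths are compared with the measure of [U] to the left of [s], not with [d]: this bound
   survives adding an interval starting at [s], and at [b] it yields a total below [d]. *)
pose Q s := a <= s <= b /\ exists l : seq (R * R),
  [/\ (forall i, i \in l -> a <= i.1 /\ i.1 <= i.2 /\ i.2 <= s),
      pairwise (fun i j : R * R => j.2 <= i.1) l,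
      ((\sum_(i <- l) (i.2 - i.1))%:E <= mu (U `&` `[a, s[%classic))%E &
      `|G s - G a| <= \sum_(i <- l) `|G i.2 - G i.1| + e * (s - a)].
suff [_ [l [l1 l2 l3 l4]]] : Q b.
  rewrite mulrDr mulr1 (le_trans l4)// lerD2r ltW// acGd// -lte_fin.
  apply: le_lt_trans l3 (le_lt_trans _ muU).
  by apply: le_measure; rewrite ?inE//; apply: measurableI.
have Qa : Q a.
  split; first by rewrite lexx ltW.
  exists [::]; split => //; first by rewrite big_nil.
  by rewrite big_nil !subrr normr0 mulr0 addr0.
have step c : a <= c <= b -> exists2 r, 0 < r & forall s t,
    c - r < s -> s <= c -> c <= t -> t < c + r -> t <= b -> Q s -> Q t.
  (* Around a point of [N] a whole ball lies in [U], so the interval from [s] to [t] joins the list.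
     Around any other point the increments over [[s, c]] and [[c, t]] are small and the list stays
     as it is. *)
  move=> cab; have [Nc|nNc] := pselect (N c).
    have /nbhs_ballP[r r0 rU] : nbhs c U by apply: open_nbhs_nbhs; split => //; apply/N'U/NN'.
    exists r => // s t crs sc ct tcr tb [/andP[as_ sb] [l [l1 l2 l3 l4]]].
    have st : s <= t by exact: le_trans ct.
    split; first by rewrite tb andbT (le_trans as_).
    exists ((s, t) :: l); split.
    - move=> i; rewrite inE => /predU1P[->//|/l1[? [? ?]]]; split => //; split => //.
      exact: le_trans st.
    - by rewrite pairwise_cons l2 andbT; apply/allP => i /l1[_ []].
    - rewrite big_cons/= EFinD.
      rewrite (_ : U `&` `[a, t[%classic = `[s, t[%classic `|` (U `&` `[a, s[%classic)); last first.
        apply/seteqP; split => x/=; rewrite !in_itv/=.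
          move=> [Ux /andP[ax xt]]; have [sx|xs] := leP s x; first by left.
          by right; rewrite ax.
        move=> [/andP[sx xt]|[Ux /andP[ax xs]]].
          split; last by rewrite xt (le_trans as_).
          by apply: rU; rewrite /ball/= ltr_distlC; apply/andP; split; lra.
        by split => //; rewrite ax (lt_le_trans xs).
      rewrite measureU//=; last 2 first.
      + exact: measurableI.
      + apply/seteqP; split => x//=; rewrite !in_itv/=.
        by move=> [/andP[sx _] [_ /andP[_]]]; rewrite ltNge sx.
      apply: leeD => //; rewrite lebesgue_measure_itv/= lte_fin; case: ifPn => [//|].
      by rewrite -leNgt => ts; rewrite lee_fin subr_le0.
    - rewrite big_cons/=; have := ler_normD (G t - G s) (G s - G a).
      rewrite addrA subrK => /le_trans; apply; rewrite -addrA lerD2l.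
      by rewrite (le_trans l4)// lerD2l ler_pM2l// lerD2r.
  have [r r0 H] := is_derive0_dist (DG _ cab nNc) _ e0.
  exists r => // s t crs sc ct tcr tb [/andP[as_ sb] [l [l1 l2 l3 l4]]].
  have st : s <= t by exact: le_trans ct.
  split; first by rewrite tb andbT (le_trans as_).
  exists l; split => //.
  - by move=> i /l1[? [? ?]]; split => //; split => //; exact: le_trans st.
  - apply: le_trans l3 _; apply: le_measure; rewrite ?inE//; try exact: measurableI.
    apply: setIS => x/=; rewrite !in_itv/= => /andP[-> xs]/=; exact: lt_le_trans st.
  - have Ht := H t; have Hs := H s.
    rewrite ger0_norm ?subr_ge0// in Ht; rewrite ler0_norm ?subr_le0// in Hs.
    have {}Ht := Ht ltac:(lra); have {}Hs := Hs ltac:(lra).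
    rewrite (_ : G t - G a = (G t - G c) - (G s - G c) + (G s - G a)); last by ring.
    rewrite (le_trans (ler_normD _ _))// (le_trans (lerD (ler_normB _ _) (lexx _)))//.
    apply: le_trans (lerD (lerD Ht Hs) l4) _; lra.
(* [step] at [sup S] carries a point of [S] from just below [sup S] to [b] if [b] is within reach,
   and otherwise strictly beyond [sup S], which is absurd. *)
pose S := [set s | Q s].
have supS : has_sup S.
  by split; [exists a|exists b => s [/andP[]]].
have aS : a <= sup S by apply: ub_le_sup => //; exact: supS.2.
have Sb : sup S <= b by apply: ge_sup; [exists a|move=> s [/andP[]]].
have [r r0 H] := step (sup S) ltac:(by rewrite aS).
have [s Ss ss] := sup_adherent r0 supS.
have sS : s <= sup S by apply: ub_le_sup => //; exact: supS.2.
have [br|rb] := leP b (sup S + r / 2).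
  by apply: (H s b) => //; rewrite (le_lt_trans br)// ltrD2l ltr_pdivrMr// mulr2n; lra.
have : Q (sup S + r / 2) by apply: (H s) => //; lra.
move=> QS; have : sup S + r / 2 <= sup S by apply: ub_le_sup => //; exact: supS.2.
by rewrite gerDl leNgt divr_gt0.
Qed.

End abs_cont_theory.

Lemma ae_impl {d} {T : measurableType d} {R : realType}
    (m : {measure set T -> \bar R}) (P Q : T -> Prop) :
  (forall x, P x -> Q x) -> {ae m, forall x, P x} -> {ae m, forall x, Q x}.
Proof. by move=> PQ; apply: negligibleS => x /= nQ /PQ. Qed.

Lemma ae_and {d} {T : measurableType d} {R : realType}
    (m : {measure set T -> \bar R}) (P Q : T -> Prop) :
  {ae m, forall x, P x} -> {ae m, forall x, Q x} ->
  {ae m, forall x, P x /\ Q x}.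
Proof.
move=> mP mQ; apply: negligibleS (negligibleU mP mQ) => x /= /not_andP[]; by [left|right].
Qed.

(** * The fundamental theorem of calculus for absolutely continuous functions *)

Section FTC_abs_cont.
Context {R : realType}.
Implicit Types (a b c : R) (f g F G : R -> R).
Notation mu := (@lebesgue_measure R).

Lemma abs_cont_Rintegral {a b f} : mu.-integrable setT (EFin \o f) ->
  abs_cont a b (fun t => Rintegral mu `[a, t] f).
Proof.
move=> intf e e0.
have intfS (A : set R) : measurable A -> mu.-integrable A (EFin \o f).
  by move=> mA; exact: integrableS intf.
have fnf (A : set R) : measurable A ->
    (\int[mu]_(x in A) (`|f x|)%:E \is a fin_num)%E.
  by move=> mA; apply: integrable_fin_num => //; apply: integrable_norm; exact: intfS.
have [d [d0 H]] := integral_normr_continuous intf e0.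
exists d => // n s H1 H2 H3.
(* Left-open intervals: the given ones may share endpoints, and these must be disjoint. Their union
   has small measure, so absolute continuity of the integral applies to it. *)
pose I (i : 'I_n) := `](s i).1, (s i).2]%classic.
have mI i : measurable (I i) by exact: measurable_itv.
have tI : trivIset setT I.
  move=> i j _ _ [x []]; rewrite /I/= !in_itv/= => /andP[xi1 xi2] /andP[xj1 xj2].
  apply/eqP/negPn/negP => /H2[ij|ji].
    by have := le_lt_trans ij xj1; rewrite ltNge xi2.
  by have := le_lt_trans ji xi1; rewrite ltNge xj2.
pose A := \big[setU/set0]_(i < n) I i.
have mA : measurable A by exact: bigsetU_measurable.
have muA : (mu A < d%:E)%E.
  rewrite measure_semi_additive_ord//.
  apply: (@le_lt_trans _ _ (\sum_(i < n) ((s i).2 - (s i).1))%:E) => //.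
  rewrite -sumEFin; apply: lee_sum => i _.
  have [_ [i12 _]] := H1 i.
  suff : (mu (I i) <= ((s i).2 - (s i).1)%:E)%E by [].
  rewrite lebesgue_measure_itv/= lte_fin; case: ifPn => // _.
  by rewrite lee_fin subr_ge0.
apply: le_lt_trans (H A mA muA).
have -> : Rintegral mu A (fun x => `|f x|) = \sum_i Rintegral mu (I i) (fun x => `|f x|).
  apply: EFin_inj; rewrite -sumEFin /Rintegral fineK; last exact: fnf.
  rewrite ge0_integral_bigsetU ?index_enum_uniq//; last 2 first.
    exact: sub_trivIset tI.
    by apply/measurable_EFinP/measurable_funTS/measurableT_comp => //;
      apply/measurable_EFinP; exact: measurable_int intf.
  apply: eq_bigr => i _; rewrite fineK//; exact: fnf.
apply: ler_sum => i _; have [ai [i12 _]] := H1 i.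
rewrite Rintegral_itvB//; last exact: intfS.
by apply: le_normr_Rintegral => //; exact: intfS.
Qed.

(* The integrand is cut off outside [a, b], as it is unconstrained there. *)
Lemma is_derive_Rintegral_ae {a b f} : mu.-integrable `[a, b] (EFin \o f) ->
  {ae mu, forall t, t \in `]a, b[ ->
    is_derive t 1 (fun s => Rintegral mu `[a, s] (f \_ `[a, b])) (f t)}.
Proof.
move=> intf; set g := f \_ `[a, b].
have lg : locally_integrable setT g by exact: integrable_locally.
have intg : mu.-integrable setT (EFin \o g).
  by move: intf; rewrite integrable_mkcond// restrict_EFin.
have := lebesgue_differentiation lg; apply: ae_impl => t Lt.
rewrite in_itv/= => /andP[at_ tb].
have [||dH DH] := @FTC1_lebesgue_pt _ g (BLeft a) t b tb _ _ Lt.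
- exact: integrableS intg.
- by rewrite /= lte_fin.
apply: DeriveDef => //; rewrite -derive1E DH /g patchE mem_set//=.
by rewrite in_itv/= !ltW.
Qed.

(** Almost everywhere the primitive has derivative [f t], yet it is constantly 0 around [t]. *)
Lemma Rintegral_eq0_ae {a b f} : mu.-integrable `[a, b] (EFin \o f) ->
  (forall t, a <= t <= b -> Rintegral mu `[a, t] f = 0) ->
  {ae mu, forall t, t \in `]a, b[ -> f t = 0}.
Proof.
move=> intf f0; apply: ae_impl (is_derive_Rintegral_ae intf) => t + tab.
move=> /(_ tab) Dt; have : is_derive t 1 (cst 0 : R -> R) (f t).
  apply: near_eq_is_derive Dt; have /open_nbhs_nbhs : open_nbhs t `]a, b[%classic.
    by split => //; exact: interval_open.
  apply: filterS => s; rewrite /= in_itv/= => /andP[as_ sb].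
  rewrite -[RHS](f0 s) ?ltW//; apply: eq_Rintegral => x; rewrite inE/= in_itv/= => /andP[ax xs].
  by rewrite /= mem_set//= in_itv/= ax (le_trans xs)// ltW.
by move=> [_ <-]; rewrite derive_cst.
Qed.

(** [F] minus the primitive of [f] is absolutely continuous with derivative 0 almost everywhere,
    hence takes equal values at [a] and [b]. *)
Lemma abs_cont_FTC2 {a b F f} : a < b -> abs_cont a b F ->
  mu.-integrable `[a, b] (EFin \o f) ->
  {ae mu, forall t, t \in `]a, b[ -> is_derive t 1 F (f t)} ->
  Rintegral mu `[a, b] f = F b - F a.
Proof.
move=> ab acF intf DF.
pose g := f \_ `[a, b].
have intg : mu.-integrable setT (EFin \o g).
  by move: intf; rewrite integrable_mkcond// restrict_EFin.
pose H t := Rintegral mu `[a, t] g.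
have acH : abs_cont a b H by exact: abs_cont_Rintegral.
have DH := is_derive_Rintegral_ae intf.
(* The endpoints join the exceptional set because derivatives are only prescribed on the open
   interval. *)
pose N := ~` [set t | (t \in `]a, b[ -> is_derive t 1 F (f t)) /\
  (t \in `]a, b[ -> is_derive t 1 H (f t))] `|` [set a; b].
have : F b - H b = F a - H a.
  apply: (@ae_derive0_cst _ a b (fun t => F t - H t) N) => //.
  - exact/abs_contD/abs_contN.
  - apply: negligibleU; first exact: ae_and DF DH.
    have n1 c : mu.-negligible [set c].
      by exists [set c]; split => //; exact: lebesgue_measure_set1.
    exact: negligibleU.
  - move=> t /andP[at_ tb]; rewrite /N /= => /not_orP[/contrapT[Ft Ht] /not_orP[ta tb']].
    have tab : t \in `]a, b[.
      by rewrite in_itv/= !lt_neqAle at_ tb !andbT eq_sym; apply/andP; split; exact/eqP.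
    by rewrite -(subrr (f t)); apply: is_deriveB; [exact: Ft|exact: Ht].
rewrite /H set_itv1 Rintegral_set1 subr0 => <-.
rewrite opprB addrC subrK; apply: eq_Rintegral => t tab.
by rewrite /g/= tab.
Qed.

End FTC_abs_cont.

(** * Exchange of integrals over a slab, under domination in the parameter *)

Section Fubini_slab.
Context {d1 d2} {X : measurableType d1} {Y : measurableType d2} {R : realType}.
Variables (m1 : {sigma_finite_measure set X -> \bar R}).
Variables (m2 : {sigma_finite_measure set Y -> \bar R}).
Variables (T : set Y) (h : X -> Y -> R) (B : Y -> R).
Hypothesis mT : measurable T.
Hypothesis mh : measurable_fun (setT `*` T) (fun z : X * Y => h z.1 z.2).
Hypothesis iB : m2.-integrable T (EFin \o B).
Hypothesis hB : forall t, T t -> (\int[m1]_x (`|h x t|)%:E <= (B t)%:E)%E.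

(** Extension by 0 to the whole product, where Fubini's theorem lives; [h] is only measurable on the
    slab. *)
Let k (z : X * Y) : \bar R := ((fun z : X * Y => h z.1 z.2) \_ (setT `*` T) z)%:E.

Let mk : measurable_fun setT k.
Proof.
apply/measurable_EFinP; apply/(measurable_restrictT _ _).1 => //.
exact: measurableX.
Qed.

Let kE x t : k (x, t) = ((EFin \o h x) \_ T) t.
Proof.
rewrite /k !patchE/=; have [tT|tT] := boolP (t \in T).
  by rewrite mem_set//; split => //=; rewrite inE in tT.
by rewrite memNset// => -[_ /= Tt]; rewrite mem_set in tT.
Qed.

Let kT x t : T t -> k (x, t) = (h x t)%:E.
Proof. by move=> Tt; rewrite kE patchE mem_set. Qed.

Let k0 x t : ~ T t -> k (x, t) = 0%E.
Proof. by move=> Tt; rewrite kE patchE memNset. Qed.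

(** Tonelli with the integral over [X] innermost: that is the one [B] dominates. *)
Let ik : (m1 \x m2)%E.-integrable setT k.
Proof.
apply/(integrable21ltyP _ _ mk).
have BT : (\int[m2]_(t in T) `|(B t)%:E| < +oo)%E by case/integrableP: iB.
apply: le_lt_trans BT; rewrite [leRHS]integral_mkcond.
apply: ge0_le_integral => //.
- by move=> t _; exact: integral_ge0.
- apply: (measurable_fun_fubini_tonelli_G (abse \o k)) => //=.
  exact: measurableT_comp.
- apply/(measurable_restrictT _ _).1 => //; apply: measurableT_comp => //.
  exact: measurable_int iB.
- move=> t _; rewrite patchE; have [tT|tT] := boolP (t \in T).
    rewrite inE in tT; under eq_integral do rewrite kT//.
    by rewrite (le_trans (hB _ tT))// lee_fin ler_norm.
  rewrite notin_setE in tT.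
  by rewrite integral0_eq// => x _; rewrite k0// abse0.
Qed.

Lemma slab_integrable1 : {ae m1, forall x, m2.-integrable T (EFin \o h x)}.
Proof.
apply: (ae_impl _ _ _ _ (ae_integrable1 ik)) => x.
rewrite (integrable_mkcond _ mT); congr (is_true (integrable _ _ _)).
by apply/funext => t; rewrite kE.
Qed.

Let kF x : (\int[m2]_t k (x, t) = \int[m2]_(t in T) (h x t)%:E)%E.
Proof. by rewrite [RHS]integral_mkcond; apply: eq_integral => t _; rewrite kE. Qed.

Let kG : (fun t => \int[m1]_x k (x, t))%E = (fun t => \int[m1]_x (h x t)%:E)%E \_ T.
Proof.
apply/funext => t; rewrite patchE; have [tT|tT] := boolP (t \in T).
  by rewrite inE in tT; under eq_integral do rewrite kT//.
by rewrite notin_setE in tT; rewrite integral0_eq// => x _; rewrite k0.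
Qed.

Lemma slab_measurable1 :
  measurable_fun setT (fun x => \int[m2]_(t in T) (h x t)%:E)%E.
Proof.
by under eq_fun do rewrite -kF; exact: measurable_fubini_F ik.
Qed.

Lemma slab_integrable2 : m2.-integrable T (fun t => \int[m1]_x (h x t)%:E)%E.
Proof.
apply: (le_integrable mT _ _ iB).
  by apply/(measurable_restrictT _ mT).2; rewrite -kG; exact: measurable_fubini_G ik.
move=> t Tt; rewrite (le_trans (le_abse_integral _ measurableT _))//.
  under eq_fun do rewrite -kT//; exact: measurableT_comp.
by rewrite (le_trans (hB _ Tt))// lee_fin ler_norm.
Qed.

Lemma slab_Fubini :
  (\int[m1]_x \int[m2]_(t in T) (h x t)%:E = \int[m2]_(t in T) \int[m1]_x (h x t)%:E)%E.
Proof.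
under eq_integral do rewrite -kF.
by rewrite (Fubini ik) [RHS]integral_mkcond -kG.
Qed.

End Fubini_slab.

(** Bounds linear in [M] and [S] pass through integrals; optimising over [l] afterwards recovers
    Cauchy-Schwarz. *)
Lemma le_sqrtM_of_amgm {R : realType} (A M S : R) : 0 <= M -> 0 <= S ->
  (forall l, 0 < l -> 2 * A <= l * M + l^-1 * S) ->
  A <= Num.sqrt M * Num.sqrt S.
Proof.
move=> M0 S0 H; have [A0|A0] := leP A 0.
  by rewrite (le_trans A0)// mulr_ge0// sqrtr_ge0.
have [M_eq0|M_neq0] := eqVneq M 0.
  (* This [l] would give [2 * A <= A * S / (S + 1)], impossible for [0 < A]. *)
  have := H ((S + 1) / A); rewrite divr_gt0 ?ltr_wpDl// => /(_ isT).
  rewrite M_eq0 mulr0 add0r invf_div mulrAC ler_pdivlMr ?ltr_wpDl//; nra.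
have Mgt0 : 0 < M by rewrite lt_neqAle eq_sym M_neq0.
have [S_eq0|S_neq0] := eqVneq S 0.
  by have := H (A / M); rewrite divr_gt0// => /(_ isT); rewrite S_eq0 mulr0 addr0 divfK//; lra.
have Sgt0 : 0 < S by rewrite lt_neqAle eq_sym S_neq0.
set m := Num.sqrt M; set s := Num.sqrt S.
have m0 : 0 < m by rewrite sqrtr_gt0.
have s0 : 0 < s by rewrite sqrtr_gt0.
(* The minimiser of [l * m ^+ 2 + l^-1 * s ^+ 2]. *)
have := H (s / m); rewrite divr_gt0// => /(_ isT).
rewrite -(sqr_sqrtr M0) -(sqr_sqrtr S0) -/m -/s.
rewrite [X in _ <= X](_ : _ = 2 * (m * s)); first by rewrite ler_pM2l.
by field; rewrite !gt_eqF.
Qed.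

(** * Cauchy-Schwarz at one parameter: [u] is the density, [w] its derivative in t, [v] the
    estimation error *)

Section fixed_parameter.
Context {d} {X : measurableType d} {R : realType}.
Variables (nu : {measure set X -> \bar R}) (u w v : X -> R) (I M a b : R).
Hypothesis u0 : forall x, 0 <= u x.
Hypothesis wu : forall x, u x = 0 -> w x = 0.
Hypothesis mw : measurable_fun setT w.
Hypothesis mv : measurable_fun setT v.
Hypothesis iu : nu.-integrable setT (EFin \o u).
Hypothesis u1 : Rintegral nu setT u = 1.
Hypothesis iI : nu.-integrable setT (EFin \o (fun x => w x ^+ 2 / u x)).
Hypothesis IE : Rintegral nu setT (fun x => w x ^+ 2 / u x) = I.
Hypothesis iM : nu.-integrable setT (EFin \o (fun x => v x ^+ 2 * u x)).
Hypothesis vM : Rintegral nu setT (fun x => v x ^+ 2 * u x) <= M.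

Let mu_ : measurable_fun setT u.
Proof. by apply/measurable_EFinP; exact: measurable_int iu. Qed.

Let I0 : 0 <= I.
Proof. by rewrite -IE; apply: Rintegral_ge0 => x _; rewrite divr_ge0// sqr_ge0. Qed.

Let M0 : 0 <= M.
Proof.
by apply: le_trans vM; apply: Rintegral_ge0 => x _; rewrite mulr_ge0// sqr_ge0.
Qed.

Let iZ f k : nu.-integrable setT (EFin \o f) ->
  nu.-integrable setT (EFin \o (fun x => k * f x)).
Proof. by move=> /(integrableZl measurableT k); apply: eq_integrable. Qed.

Let iD f g : nu.-integrable setT (EFin \o f) -> nu.-integrable setT (EFin \o g) ->
  nu.-integrable setT (EFin \o (fun x => f x + g x)).
Proof. by move=> f1 g1; apply: eq_integrable (integrableD measurableT f1 g1). Qed.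

Let RZ f k : nu.-integrable setT (EFin \o f) ->
  Rintegral nu setT (fun x => k * f x) = k * Rintegral nu setT f.
Proof. by move=> fi; rewrite RintegralZl. Qed.

Let ile (f g : X -> R) : measurable_fun setT f -> (forall x, `|f x| <= g x) ->
  nu.-integrable setT (EFin \o g) -> nu.-integrable setT (EFin \o f).
Proof.
move=> mf fg; apply: le_integrable => //; first exact/measurable_EFinP.
by move=> x _; rewrite /= lee_fin (le_trans (fg x))// ler_norm.
Qed.

(* Weighted AM-GM; [u z = 0] forces [w z = 0], so division by [0] is harmless. *)
Let amgm (x y c l : R) z : 0 < l ->
  2 * `|x * (y * u z + c * w z)| <= l * (x ^+ 2 * u z) +
    l^-1 * (y ^+ 2 * u z + 2 * y * c * w z + c ^+ 2 * (w z ^+ 2 / u z)).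
Proof.
move=> l0; have [uz0|uz0] := eqVneq (u z) 0.
  by rewrite wu// uz0 !(mul0r,mulr0,addr0) normr0 mulr0 expr0n/= !(mul0r,mulr0,addr0).
have uz : 0 < u z by rewrite lt_neqAle eq_sym uz0 u0.
set m := y * u z + c * w z.
have -> : y ^+ 2 * u z + 2 * y * c * w z + c ^+ 2 * (w z ^+ 2 / u z) = m ^+ 2 / u z.
  by rewrite /m; field.
rewrite normrM.
have := sqr_ge0 (l * (`|x| * u z) - `|m|).
rewrite sqrrB !exprMn !real_normK ?num_real// => H.
rewrite -(ler_pM2l (mulr_gt0 l0 uz)).
rewrite [leRHS](_ : _ = l ^+ 2 * (x ^+ 2 * u z ^+ 2) + m ^+ 2); last first.
  by field; rewrite uz0 gt_eqF.
rewrite -subr_ge0; apply: le_trans H _; rewrite le_eqVlt; apply/orP; left; apply/eqP.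
ring.
Qed.

Let wle x : `|w x| <= 2^-1 * (u x + w x ^+ 2 / u x).
Proof.
have := amgm 1 0 1 1 x ltr01; rewrite invr1 !mul1r !expr1n expr0n/= !(mul0r, mulr0) !mul1r !add0r.
lra.
Qed.

Let iW : nu.-integrable setT (EFin \o (fun x => 2^-1 * (u x + w x ^+ 2 / u x))).
Proof. exact/iZ/iD. Qed.

Let WE : Rintegral nu setT (fun x => 2^-1 * (u x + w x ^+ 2 / u x)) = 2^-1 * (1 + I).
Proof. by rewrite RintegralZl//; [rewrite RintegralD// u1 IE|exact: iD]. Qed.

Let norm_le (f g : X -> R) : measurable_fun setT f -> (forall x, `|f x| <= g x) ->
  nu.-integrable setT (EFin \o g) ->
  (\int[nu]_x (`|f x|)%:E <= (Rintegral nu setT g)%:E)%E.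
Proof.
move=> mf fg ig; have inf : nu.-integrable setT (EFin \o f) by exact: ile ig.
rewrite fineK; last exact: integrable_fin_num.
apply: ge0_le_integral => //.
- by apply/measurable_EFinP/measurableT_comp.
- exact: measurable_int ig.
- by move=> x _; rewrite lee_fin.
Qed.

Lemma score_integrable : nu.-integrable setT (EFin \o w).
Proof. by apply: ile iW. Qed.

Lemma score_norm_le : (\int[nu]_x (`|w x|)%:E <= (2^-1 * (1 + I))%:E)%E.
Proof. by rewrite -WE; apply: norm_le. Qed.

Let mD : measurable_fun setT (fun x => v x * (b * u x + a * w x)).
Proof.
apply: measurable_funM => //; apply: measurable_funD; exact: measurable_funM.
Qed.

(** [amgm] with [l = 1], except that the cross term [b * a * w] is bounded through [wle]: the
    domination is needed at every parameter, also where [w] is not known to have mean 0. *)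
Let V x := 2^-1 * (v x ^+ 2 * u x) +
  (2^-1 * (b ^+ 2) * u x + 2^-1 * (a ^+ 2) * (w x ^+ 2 / u x)
  + `|b * a| * (2^-1 * (u x + w x ^+ 2 / u x))).

Let iV : nu.-integrable setT (EFin \o V).
Proof. by apply: iD; [exact: iZ|apply: iD; [apply: iD; exact: iZ|exact: iZ]]. Qed.

Let VE : Rintegral nu setT V <= 2^-1 * M +
  (2^-1 * (b ^+ 2) + 2^-1 * (a ^+ 2) * I + `|b * a| * (2^-1 * (1 + I))).
Proof.
rewrite /V RintegralD//; last 2 first.
- exact: iZ.
- by apply: iD; [apply: iD; exact: iZ|exact: iZ].
rewrite RintegralD//; last 2 first.
- by apply: iD; exact: iZ.
- exact: iZ.
rewrite RintegralD//; last 2 first.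
- exact: iZ.
- exact: iZ.
by rewrite (RZ _ _ iM) (RZ _ _ iu) (RZ _ _ iI) (RZ _ _ iW) WE u1 IE mulr1 lerD2r ler_pM2l.
Qed.

Let leV x : `|v x * (b * u x + a * w x)| <= V x.
Proof.
have := amgm (v x) b a 1 x ltr01; rewrite invr1 !mul1r => H.
have : b * a * w x <= `|b * a| * (2^-1 * (u x + w x ^+ 2 / u x)).
  by rewrite (le_trans (ler_norm _))// normrM ler_wpM2l.
rewrite /V; lra.
Qed.

Lemma cross_integrable : nu.-integrable setT (EFin \o (fun x => v x * (b * u x + a * w x))).
Proof. by apply: ile iV. Qed.

(** The extra [- a * u] is the contribution of differentiating the error, whose derivative in t is
    -1. *)
Lemma cross_norm_le :
  (\int[nu]_x (`|v x * (b * u x + a * w x) - a * u x|)%:E <=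
    (2^-1 * M + (2^-1 * (b ^+ 2) + 2^-1 * (a ^+ 2) * I + `|b * a| * (2^-1 * (1 + I)))
     + `|a|)%:E)%E.
Proof.
have H : nu.-integrable setT (EFin \o (fun x => V x + `|a| * u x)).
  by apply: iD => //; exact: iZ.
apply: (le_trans (norm_le _ _ _ _ H)).
- by apply: measurable_funB => //; exact: measurable_funM.
- by move=> x; rewrite (le_trans (ler_normB _ _))// lerD// normrM (ger0_norm (u0 x)).
- rewrite lee_fin RintegralD//; last exact: iZ.
  by rewrite lerD// RintegralZl// u1 mulr1.
Qed.

Lemma cross_Cauchy_Schwarz : Rintegral nu setT w = 0 ->
  `|Rintegral nu setT (fun x => v x * (b * u x + a * w x))| <=
    Num.sqrt M * Num.sqrt (I * a ^+ 2 + b ^+ 2).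
Proof.
move=> w0; apply: le_sqrtM_of_amgm => //.
  by apply: addr_ge0; [apply: mulr_ge0 => //|]; exact: sqr_ge0.
move=> l l0.
(* [(b * u + a * w) ^+ 2 / u] expanded, so that the middle term integrates to 0 by [w0]. *)
pose W x := b ^+ 2 * u x + (2 * b * a * w x + a ^+ 2 * (w x ^+ 2 / u x)).
have iw := score_integrable.
have iW' : nu.-integrable setT (EFin \o W).
  by apply: iD; [exact: iZ|apply: iD; exact: iZ].
have WE' : Rintegral nu setT W = I * a ^+ 2 + b ^+ 2.
  rewrite /W RintegralD//; [|exact: iZ|by apply: iD; exact: iZ].
  rewrite RintegralD//; [|exact: iZ|exact: iZ].
  by rewrite (RZ _ _ iu) (RZ _ _ iw) (RZ _ _ iI) u1 IE w0; ring.
have H : Rintegral nu setT (fun x => `|v x * (b * u x + a * w x)|) <=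
    Rintegral nu setT (fun x => 2^-1 * (l * (v x ^+ 2 * u x) + l^-1 * W x)).
  apply: le_Rintegral => //.
  - by apply: integrable_norm; exact: cross_integrable.
  - by apply/iZ/iD; exact: iZ.
  - by move=> x _; have := amgm (v x) b a l x l0; rewrite /W; lra.
have := le_trans (le_normr_Rintegral measurableT cross_integrable) H.
rewrite RintegralZl//; last by apply: iD; exact: iZ.
rewrite RintegralD//; [|exact: iZ|exact: iZ].
rewrite (RZ _ _ iM) (RZ _ _ iW') WE'.
have := ler_wpM2l (ltW l0) vM; lra.
Qed.

End fixed_parameter.

(** * Measurability and integrability criteria *)

Lemma measurable_fun_slice {d1 d2} {X : measurableType d1} {Y : measurableType d2}
    {R : realType} (T : set Y) (h : X -> Y -> R) (t : Y) : measurable T ->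
  measurable_fun (setT `*` T) (fun z : X * Y => h z.1 z.2) -> T t ->
  measurable_fun setT (h ^~ t).
Proof.
move=> mT mh Tt.
apply: (@measurable_comp _ _ _ _ _ _ (setT `*` T) (fun z : X * Y => h z.1 z.2) setT (fun x => (x, t))) => //.
- exact: measurableX.
- by move=> _ [x _ <-].
Qed.

Lemma ge0_integrable_le {d} {X : measurableType d} {R : realType}
    (m : {measure set X -> \bar R}) (f : X -> R) (r : R) :
  measurable_fun setT f -> (forall x, 0 <= f x) ->
  (\int[m]_x (f x)%:E <= r%:E)%E ->
  m.-integrable setT (EFin \o f) /\ Rintegral m setT f <= r.
Proof.
move=> mf f0 fr; have inf : m.-integrable setT (EFin \o f).
  apply/integrableP; split; first exact/measurable_EFinP.
  apply: le_lt_trans (ltry r); apply: le_trans fr.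
  by rewrite le_eqVlt; apply/orP; left; apply/eqP; apply: eq_integral => x _ /=;
    rewrite ger0_norm.
by split => //; rewrite -lee_fin fineK//; exact: integrable_fin_num.
Qed.

Section abs_cont_measurable.
Context {R : realType}.
Notation mu := (@lebesgue_measure R).

Lemma abs_cont_measurable {a b : R} {f} : abs_cont a b f -> measurable_fun `[a, b] f.
Proof.
move=> /abs_cont_continuous; apply: subspace_continuous_measurable_fun.
exact: measurable_itv.
Qed.

Lemma bounded_integrable_itv {a b C : R} {f : R -> R} :
  measurable_fun `[a, b] f -> (forall t, a <= t <= b -> `|f t| <= C) ->
  mu.-integrable `[a, b] (EFin \o f).
Proof.
move=> mf fC; apply: measurable_bounded_integrable => //.
  suff : (mu `[a, b]%classic < +oo)%E by [].
  by rewrite lebesgue_measure_itv/=; case: ifP => _; exact: ltry.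
exists C; split; first exact: num_real.
move=> x Cx t; rewrite /= in_itv/= => tab; exact: le_trans (fC _ tab) (ltW Cx).
Qed.

Lemma abs_cont_integrable {a b : R} {f} : abs_cont a b f ->
  mu.-integrable `[a, b] (EFin \o f).
Proof.
move=> acf; have [C _ fC] := abs_cont_bounded acf.
exact: bounded_integrable_itv (abs_cont_measurable acf) fC.
Qed.

End abs_cont_measurable.

(** * The integral inequality for a repaired score [g] and a bounded measurable [da] *)

Section van_Trees.
Context {d} {X : measurableType d} {R : realType}.
Notation mu := (@lebesgue_measure R).
Variables (nu : {sigma_finite_measure set X -> \bar R}) (q g : X -> R -> R).
Variables (t1 t2 : R) (I al da : R -> R) (th : X -> R) (M C : R).
Local Notation T := (`[t1, t2]%classic : set R).
Hypothesis t12 : t1 < t2.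
Hypothesis mq : measurable_fun (setT `*` T) (fun z : X * R => q z.1 z.2).
Hypothesis mg : measurable_fun (setT `*` T) (fun z : X * R => g z.1 z.2).
Hypothesis q0 : forall x t, t1 <= t <= t2 -> 0 <= q x t.
Hypothesis qg : forall x t, q x t = 0 -> g x t = 0.
Hypothesis q1 : forall t, t1 <= t <= t2 -> (\int[nu]_x (q x t)%:E = 1)%E.
Hypothesis acq : {ae nu, forall x, abs_cont t1 t2 (q x)}.
Hypothesis Dq : {ae nu, forall x, {ae mu, forall t,
  t \in `]t1, t2[ -> is_derive t 1 (q x) (g x t)}}.
Hypothesis gI : forall t, t1 <= t <= t2 ->
  (\int[nu]_x ((g x t) ^+ 2 / q x t)%:E = (I t)%:E)%E.
Hypothesis acI : abs_cont t1 t2 I.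
Hypothesis acal : abs_cont t1 t2 al.
Hypothesis mda : measurable_fun `[t1, t2] da.
Hypothesis daC : forall t, t1 <= t <= t2 -> `|da t| <= C.
Hypothesis Dal : {ae mu, forall t, t \in `]t1, t2[ -> is_derive t 1 al (da t)}.
Hypothesis al1 : al t1 = 0.
Hypothesis al2 : al t2 = 0.
Hypothesis mth : measurable_fun setT th.
Hypothesis thM : forall t, t1 <= t <= t2 ->
  (\int[nu]_x ((th x - t) ^+ 2 * q x t)%:E <= M%:E)%E.

Let TE t : T t = (t1 <= t <= t2) :> Prop. Proof. by rewrite /= in_itv. Qed.

Let mT : measurable T. Proof. exact: measurable_itv. Qed.

Let mq_ t : t1 <= t <= t2 -> measurable_fun setT (q ^~ t).
Proof. by move=> tT; apply: (measurable_fun_slice _ _ _ mT mq); rewrite TE. Qed.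

Let mg_ t : t1 <= t <= t2 -> measurable_fun setT (g ^~ t).
Proof. by move=> tT; apply: (measurable_fun_slice _ _ _ mT mg); rewrite TE. Qed.

Let iq t : t1 <= t <= t2 -> nu.-integrable setT (EFin \o (q ^~ t)).
Proof.
move=> tT; have [] := ge0_integrable_le nu (q ^~ t) 1 (mq_ _ tT) (fun x => q0 x _ tT) => //.
by rewrite q1.
Qed.

Let q1_ t : t1 <= t <= t2 -> Rintegral nu setT (q ^~ t) = 1.
Proof. by move=> tT; rewrite /Rintegral q1. Qed.

Let iI t : t1 <= t <= t2 ->
  nu.-integrable setT (EFin \o (fun x => g x t ^+ 2 / q x t)).
Proof.
move=> tT; have [] := ge0_integrable_le nu (fun x => g x t ^+ 2 / q x t) (I t) => //.
- apply: measurable_funM; first exact: measurable_funX (mg_ _ tT).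
  (* On nonnegative reals the power -1 is the inverse, also at 0, where both are 0. *)
  apply: (eq_measurable_fun (fun x => q x t `^ (-1))).
    by move=> x _; rewrite powR_inv1// q0.
  exact: measurableT_comp (measurable_powR _) (mq_ _ tT).
- by move=> x; rewrite divr_ge0 ?sqr_ge0 ?q0.
- by rewrite gI.
Qed.

Let I_ t : t1 <= t <= t2 -> Rintegral nu setT (fun x => g x t ^+ 2 / q x t) = I t.
Proof. by move=> tT; rewrite /Rintegral gI. Qed.

Let mv t : measurable_fun setT (fun x => th x - t).
Proof. exact: measurable_funB. Qed.

Let iM t : t1 <= t <= t2 ->
  nu.-integrable setT (EFin \o (fun x => (th x - t) ^+ 2 * q x t)) /\
  Rintegral nu setT (fun x => (th x - t) ^+ 2 * q x t) <= M.
Proof.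
move=> tT; apply: ge0_integrable_le (thM _ tT).
- apply: measurable_funM; last exact: mq_.
  exact: measurable_funX.
- by move=> x; rewrite mulr_ge0 ?sqr_ge0 ?q0.
Qed.

Let B t := 2^-1 * (1 + I t).

Let iB : mu.-integrable T (EFin \o B).
Proof.
apply: abs_cont_integrable; apply: abs_contM; last apply: abs_contD => //.
  by apply: lipschitz_abs_cont => s t; rewrite subrr normr0.
by apply: lipschitz_abs_cont => s t; rewrite subrr normr0.
Qed.

Let gB t : t1 <= t <= t2 -> (\int[nu]_x (`|g x t|)%:E <= (B t)%:E)%E.
Proof.
move=> tT; apply: (score_norm_le nu (q ^~ t) (g ^~ t) (I t)) => //.
- by move=> x; exact: q0.
- by move=> x /qg.
- exact: mg_.
- exact: iq.
- exact: q1_.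
- exact: iI.
- exact: I_.
Qed.

Let ig t : t1 <= t <= t2 -> nu.-integrable setT (EFin \o (g ^~ t)).
Proof.
move=> tT; apply: (score_integrable nu (q ^~ t) (g ^~ t)) => //.
- by move=> x; exact: q0.
- by move=> x /qg.
- exact: mg_.
- exact: iq.
- exact: iI.
Qed.

Let TS t : t1 <= t <= t2 -> `[t1, t]%classic `<=` T.
Proof.
move=> /andP[_ tt2] s; rewrite /= !in_itv/= => /andP[-> st]/=; exact: le_trans tt2.
Qed.

(** After Fubini the inner integral is [q x t - q x t1] for almost every [x], which integrates to
    [1 - 1]. *)
Let score_itv t : t1 <= t <= t2 ->
  Rintegral mu `[t1, t] (fun s => Rintegral nu setT (g ^~ s)) = 0.
Proof.
move=> tT; have /andP[t1t tt2] := tT.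
move: t1t; rewrite le_eqVlt => /predU1P[<-|t1t].
  by rewrite set_itv1 Rintegral_set1.
pose U := `[t1, t]%classic : set R.
have mU : measurable U by exact: measurable_itv.
have UT : U `<=` T by exact: TS.
have mgU : measurable_fun (setT `*` U) (fun z : X * R => g z.1 z.2).
  apply: measurable_funS mg; first exact: measurableX.
  exact: setSX.
have iBU : mu.-integrable U (EFin \o B) by exact: integrableS iB.
have gBU s : U s -> (\int[nu]_x (`|g x s|)%:E <= (B s)%:E)%E.
  by move=> /UT; rewrite TE; exact: gB.
transitivity (fine (\int[mu]_(s in U) \int[nu]_x (g x s)%:E)%E).
  congr fine; apply: eq_integral => s; rewrite inE => /UT; rewrite TE => sT.
  by rewrite fineK//; exact: integrable_fin_num (ig _ sT).
rewrite -(slab_Fubini nu mu U g B mU mgU iBU gBU).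
transitivity (fine (\int[nu]_x (q x t - q x t1)%:E)%E).
  congr fine; apply: ae_eq_integral => //.
  - exact: (slab_measurable1 nu mu U g B mU mgU iBU gBU).
  - apply/measurable_EFinP/measurable_funB; apply: mq_ => //.
    by rewrite lexx ltW.
  - have := ae_and _ _ _ (ae_and _ _ _ acq Dq)
      (slab_integrable1 nu mu U g B mU mgU iBU gBU).
    apply: ae_impl => x [[acx Dx] ix] _.
    rewrite -(@abs_cont_FTC2 _ t1 t (q x) (g x))//; last 2 first.
    + exact: abs_cont_sub acx.
    + apply: ae_impl Dx => s Ds; rewrite in_itv/= => /andP[t1s st].
      by apply: Ds; rewrite in_itv/= t1s (lt_le_trans st).
    by rewrite fineK//; exact: integrable_fin_num.
have t1T : t1 <= t1 <= t2 by rewrite lexx ltW.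
by rewrite -/(Rintegral nu setT (fun x => q x t - q x t1)) RintegralB ?q1_ ?subrr//; exact: iq.
Qed.

Lemma score_mean0_ae : {ae mu, forall t, t \in `]t1, t2[ ->
  Rintegral nu setT (g ^~ t) = 0}.
Proof.
apply: Rintegral_eq0_ae score_itv.
have gB' t : T t -> (\int[nu]_x (`|g x t|)%:E <= (B t)%:E)%E by rewrite TE; exact: gB.
apply: eq_integrable (slab_integrable2 nu mu T g B mT mg iB gB') => // t.
rewrite inE TE => tT; rewrite /= fineK//; exact: integrable_fin_num (ig _ tT).
Qed.

(** The derivative in [t] of [(th x - t) * (al t * q x t)]. *)
Let h x t := (th x - t) * (da t * q x t + al t * g x t) - al t * q x t.

Let A t := Rintegral nu setT (fun x => (th x - t) * (da t * q x t + al t * g x t)).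

Let iA t : t1 <= t <= t2 -> nu.-integrable setT
  (EFin \o (fun x => (th x - t) * (da t * q x t + al t * g x t))).
Proof.
move=> tT; apply: (cross_integrable nu (q ^~ t) (g ^~ t) (fun x => th x - t)) => //.
- by move=> x; exact: q0.
- by move=> x /qg.
- exact: mg_.
- exact: iq.
- exact: iI.
- by have [] := iM _ tT.
Qed.

Let D t := 2^-1 * M + (2^-1 * (da t ^+ 2) + 2^-1 * (al t ^+ 2) * I t
  + `|da t * al t| * (2^-1 * (1 + I t))) + `|al t|.

Let mal : measurable_fun T al. Proof. exact: abs_cont_measurable. Qed.
Let mI : measurable_fun T I. Proof. exact: abs_cont_measurable. Qed.

Let iD : mu.-integrable T (EFin \o D).
Proof.
have [K K0 alK] := abs_cont_bounded acal.
have [J J0 IJ] := abs_cont_bounded acI.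
apply: (@bounded_integrable_itv _ _ _ (2^-1 * `|M| + (2^-1 * C ^+ 2 + 2^-1 * K ^+ 2 * J
  + C * K * (2^-1 * (1 + J))) + K)).
  apply: measurable_funD; last exact: measurableT_comp.
  apply: measurable_funD => //; apply: measurable_funD; last first.
    apply: measurable_funM; first by apply: measurableT_comp => //; exact: measurable_funM.
    by apply: measurable_funM => //; exact: measurable_funD.
  apply: measurable_funD; first by apply: measurable_funM => //; exact: measurable_funX.
  by apply: measurable_funM => //; apply: measurable_funM => //; exact: measurable_funX.
move=> t tT; have dC := daC _ tT; have aK := alK _ tT; have iJ := IJ _ tT.
have C0 : 0 <= C by exact: le_trans dC.
have dC2 : da t ^+ 2 <= C ^+ 2 by rewrite -[da t ^+ 2]real_normK ?num_real// lerXn2r ?nnegrE.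
have aK2 : al t ^+ 2 <= K ^+ 2 by rewrite -[al t ^+ 2]real_normK ?num_real// lerXn2r ?nnegrE// ltW.
have J1 : `|2^-1 * (1 + I t)| <= 2^-1 * (1 + J).
  rewrite normrM ger0_norm// ler_pM2l// (le_trans (ler_normD _ _))// normr1 lerD2l//.
rewrite /D; apply: (le_trans (ler_normD _ _)); rewrite normr_id lerD//.
apply: (le_trans (ler_normD _ _)); rewrite lerD//.
  by rewrite normrM ger0_norm.
apply: (le_trans (ler_normD _ _)); rewrite lerD//; last first.
  by rewrite normrM normr_id ler_pM// normrM ler_pM.
apply: (le_trans (ler_normD _ _)); rewrite lerD//.
  by rewrite normrM (ger0_norm (sqr_ge0 _)) ger0_norm// ler_pM2l.
by rewrite normrM ler_pM// normrM (ger0_norm (sqr_ge0 _)) ger0_norm// ler_pM2l.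
Qed.

Let hD t : T t -> (\int[nu]_x (`|h x t|)%:E <= (D t)%:E)%E.
Proof.
rewrite TE => tT.
apply: (cross_norm_le nu (q ^~ t) (g ^~ t) (fun x => th x - t) (I t) M (al t) (da t)) => //.
- by move=> x; exact: q0.
- by move=> x /qg.
- exact: mg_.
- exact: iq.
- exact: q1_.
- exact: iI.
- exact: I_.
- by have [] := iM _ tT.
- by have [] := iM _ tT.
Qed.

Let mh : measurable_fun (setT `*` T) (fun z : X * R => h z.1 z.2).
Proof.
have m2 (f : R -> R) : measurable_fun T f ->
    measurable_fun (setT `*` T) (fun z : X * R => f z.2).
  move=> mf; apply: (@measurable_comp _ _ _ _ _ _ T f (setT `*` T) snd) => //.
    by move=> _ [[x t] [_ Tt] <-].
  by apply: measurable_funTS; exact: measurable_snd.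
have m1 : measurable_fun (setT `*` T) (fun z : X * R => th z.1).
  by apply: measurable_funTS; exact: measurableT_comp.
rewrite /h; apply: measurable_funB; last by apply: measurable_funM => //; exact: m2.
apply: measurable_funM; first by apply: measurable_funB => //; exact: (m2 id).
apply: measurable_funD; apply: measurable_funM => //; exact: m2.
Qed.

Let hE t : t1 <= t <= t2 -> (\int[nu]_x (h x t)%:E = (A t - al t)%:E)%E.
Proof.
move=> tT; have iaq : nu.-integrable setT (EFin \o (fun x => al t * q x t)).
  by apply: eq_integrable (integrableZl measurableT (al t) (iq _ tT)).
rewrite -[LHS]fineK; last first.
  by apply: integrable_fin_num => //; apply: eq_integrable (integrableB measurableT (iA _ tT) iaq).
rewrite -/(Rintegral nu setT (h ^~ t)) /h RintegralB//; last exact: iA.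
by rewrite RintegralZl ?q1_ ?mulr1//; exact: iq.
Qed.

Let A_al : Rintegral mu T (fun t => A t - al t) = 0.
Proof.
transitivity (fine (\int[mu]_(t in T) \int[nu]_x (h x t)%:E)%E).
  by congr fine; apply: eq_integral => t; rewrite inE TE => tT; rewrite hE.
rewrite -(slab_Fubini nu mu T h D mT mh iD hD).
transitivity (fine (\int[nu]_x (cst 0 x))%E); last by rewrite integral0.
congr fine; apply: ae_eq_integral => //; first exact: (slab_measurable1 nu mu T h D mT mh iD hD).
have := ae_and _ _ _ (ae_and _ _ _ acq Dq) (slab_integrable1 nu mu T h D mT mh iD hD).
apply: ae_impl => x [[acx Dx] ix] _.
have acth : abs_cont t1 t2 (fun t => th x - t).
  by apply: lipschitz_abs_cont => s t; rewrite (_ : _ - _ = s - t) 1?distrC//; ring.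
have := @abs_cont_FTC2 _ t1 t2 (fun t => (th x - t) * (al t * q x t)) (h x) t12
  (abs_contM acth (abs_contM acal acx)) ix.
rewrite al1 al2 !mul0r !mulr0 subrr /Rintegral => H.
rewrite -[LHS]fineK; last exact: integrable_fin_num.
rewrite {}H//; apply: ae_impl (ae_and _ _ _ Dx Dal) => t [Dxt Dat] tT.
(* Once discharged, these facts serve as instances from which the product rule is inferred. *)
have {}Dxt := Dxt tT; have {}Dat := Dat tT.
apply: is_derive_eq.
rewrite /h /GRing.scale/=; ring.
Qed.

Let S t := Num.sqrt (I t * al t ^+ 2 + da t ^+ 2).

Let iS : mu.-integrable T (EFin \o S).
Proof.
have [K K0 alK] := abs_cont_bounded acal.
have [J J0 IJ] := abs_cont_bounded acI.
apply: (@bounded_integrable_itv _ _ _ (Num.sqrt (J * K ^+ 2 + C ^+ 2))).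
  apply: (@measurableT_comp _ _ _ _ _ _ (@Num.sqrt R)).
    exact: continuous_measurable_fun (@sqrt_continuous R).
  apply: measurable_funD; last exact: measurable_funX.
  by apply: measurable_funM => //; exact: measurable_funX.
move=> t tT; have dC := daC _ tT; have aK := alK _ tT; have iJ := IJ _ tT.
have C0 : 0 <= C by exact: le_trans dC.
rewrite ger0_norm ?sqrtr_ge0// ler_wsqrtr// lerD//; last first.
  by rewrite -[da t ^+ 2]real_normK ?num_real// lerXn2r ?nnegrE.
apply: (le_trans (ler_norm _)); rewrite normrM ler_pM//.
by rewrite ger0_norm ?sqr_ge0// -[al t ^+ 2]real_normK ?num_real// lerXn2r ?nnegrE// ltW.
Qed.

Lemma van_Trees_bound : `|Rintegral mu T al| <=
  Num.sqrt M * Rintegral mu T (fun t => Num.sqrt (I t * al t ^+ 2 + da t ^+ 2)).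
Proof.
suff : `|Rintegral mu T al| <= Num.sqrt M * Rintegral mu T S by [].
have ial : mu.-integrable T (EFin \o al) by exact: abs_cont_integrable.
have iAa : mu.-integrable T (EFin \o (fun t => A t - al t)).
  apply: eq_integrable (slab_integrable2 nu mu T h D mT mh iD hD) => // t.
  by rewrite inE TE => tT; rewrite /= hE.
have iAT : mu.-integrable T (EFin \o A).
  have : mu.-integrable T ((EFin \o (fun t => A t - al t)%R) \+ (EFin \o al))%E.
    exact: integrableD.
  apply: eq_integrable => // t _.
  by rewrite /= -EFinD subrK.
have -> : Rintegral mu T al = Rintegral mu T A.
  by apply/esym/eqP; rewrite -subr_eq0 -RintegralB// A_al.
have le_norm : `|Rintegral mu T A| <= Rintegral mu T (fun t => `|A t|).
  exact: le_normr_Rintegral.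
apply: le_trans le_norm _.
rewrite -RintegralZl//.
have iMS : mu.-integrable T (EFin \o (fun t => Num.sqrt M * S t)).
  have : mu.-integrable T (fun t => (Num.sqrt M)%:E * (EFin \o S) t)%E.
    exact: integrableZl.
  by apply: eq_integrable.
apply: fine_le.
- by apply: integrable_fin_num => //; exact: integrable_norm.
- exact: integrable_fin_num.
apply: ae_ge0_le_integral => //.
- by apply: measurable_int; exact: integrable_norm iAT.
- exact: measurable_int iMS.
(* The mean-zero property is known inside the open interval only, so both endpoints are
   discarded. *)
have ae_neq (c : R) : {ae mu, forall t, t <> c}.
  by exists [set c]; split => //; [exact: lebesgue_measure_set1|move=> t /contrapT].
apply: ae_impl (ae_and _ _ _ score_mean0_ae (ae_and _ _ _ (ae_neq t1) (ae_neq t2))).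
move=> t [g0 [/eqP tt1 /eqP tt2]]; rewrite TE => tT; rewrite lee_fin.
have [iMt leM] := iM _ tT.
apply: (cross_Cauchy_Schwarz nu (q ^~ t) (g ^~ t) (fun x => th x - t)) => //.
- by move=> x; exact: q0.
- by move=> x /qg.
- exact: mg_.
- exact: iq.
- exact: q1_.
- exact: iI.
- exact: I_.
- by apply: g0; rewrite in_itv/= !lt_neqAle tt2 eq_sym tt1.
Qed.

End van_Trees.

(** * Signs of derivatives, and a measurable version of a derivative *)

Section derivative_sign.
Context {R : realType}.
Notation mu := (@lebesgue_measure R).
Implicit Types (f : R -> R) (a b c t : R).

Lemma is_derive_gt0_near {f t c} : is_derive t 1 f c -> 0 < c ->
  exists2 d : R, 0 < d & forall h, h != 0 -> `|h| < d -> 0 < h * (f (t + h) - f t).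
Proof.
move=> [df Df] c0.
have : h^-1 *: ((f \o shift t) (h *: 1) - f t) @[h --> 0^'] --> 'D_1 f t := df.
rewrite Df => /cvgrPdist_lt/(_ _ c0).
rewrite near_withinE => /nbhs_ballP[d d0 H]; exists d => // h h0 hd.
have := H h; rewrite /ball/= sub0r normrN => /(_ hd h0).
rewrite [_ *: 1]mulr1 (addrC h t) ltr_norml => /andP[_].
rewrite ltrBlDr ltrDl => H'.
have : 0 < h ^+ 2 * (h^-1 * (f (t + h) - f t)).
  by rewrite mulr_gt0// lt_neqAle eq_sym expf_eq0/= h0 sqr_ge0.
by rewrite mulrA expr2 mulfK.
Qed.

(** Meant for the zeros of a density, which are minima: there the derivative, if any, is 0. *)
Lemma is_derive_min0 {f a b t c} : a < t < b -> is_derive t 1 f c ->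
  (forall s, a < s < b -> f t <= f s) -> c = 0.
Proof.
move=> /andP[at_ tb] Df fmin.
have [c0|c0|//] := ltgtP c 0.
- have Nc0 : 0 < - c by rewrite oppr_gt0.
  have [d d0 H] := is_derive_gt0_near (is_deriveN Df) Nc0.
  pose h := Num.min (d / 2) ((b - t) / 2).
  have h0 : 0 < h by rewrite lt_min !divr_gt0// subr_gt0.
  have hd : h <= d / 2 by rewrite ge_min lexx.
  have hb : h <= (b - t) / 2 by rewrite ge_min lexx orbT.
  have := H h; rewrite gt_eqF// gtr0_norm// => /(_ isT).
  have -> : h < d by lra.
  move=> /(_ isT); rewrite pmulr_rgt0//=.
  have := fmin (t + h) ltac:(lra); rewrite !fctE; lra.
- have [d d0 H] := is_derive_gt0_near Df c0.
  pose h := Num.min (d / 2) ((t - a) / 2).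
  have h0 : 0 < h by rewrite lt_min !divr_gt0// subr_gt0.
  have hd : h <= d / 2 by rewrite ge_min lexx.
  have hb : h <= (t - a) / 2 by rewrite ge_min lexx orbT.
  have := H (- h); rewrite oppr_eq0 gt_eqF// normrN gtr0_norm// => /(_ isT).
  have -> : h < d by lra.
  move=> /(_ isT); rewrite nmulr_rgt0 ?oppr_lt0//=.
  have := fmin (t - h) ltac:(lra); lra.
Qed.

(* [df] itself need not be Borel: it is only prescribed almost everywhere.  Its
   sign is recovered from the difference quotients of [f] along [1 / n]. *)
Lemma measurable_derivative {f df : R -> R} {a b} :
  measurable_fun `[a, b] f -> measurable_fun `[a, b] (fun t => df t ^+ 2) ->
  {ae mu, forall t, t \in `]a, b[ -> is_derive t 1 f (df t)} ->
  exists dg : R -> R, [/\ measurable_fun `[a, b] dg,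
    forall t, dg t ^+ 2 = df t ^+ 2 &
    {ae mu, forall t, t \in `]a, b[ -> is_derive t 1 f (dg t)}].
Proof.
move=> mf mdf2 Df.
pose g := f \_ `[a, b].
have mg : measurable_fun setT g by exact/(measurable_restrictT _ _).1.
(* The points where the increments of [g] along [1 / n] are eventually positive, written with
   countable operations. *)
pose E : set R := \bigcup_m \bigcap_n [set t | g t < g (t + (m + n).+1%:R^-1)].
have mE : measurable E.
  apply: bigcupT_measurable => m; apply: bigcapT_measurable => n.
  rewrite -[X in measurable X]setTI.
  apply: (@measurable_fun_ltr _ _ _ setT g (fun t => g (t + (m + n).+1%:R^-1)) mg _ measurableT [set true]) => //.
  apply: measurableT_comp => //; exact: measurable_funD.
(* The absolute value of [df], measurable as the root of a measurable square, times the sign: 1 on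
   [E] and -1 off it. *)
pose dg t := Num.sqrt (df t ^+ 2) * (2 * \1_E t - 1).
have gE t : a <= t <= b -> g t = f t by move=> tab; rewrite /g patchE mem_set//= in_itv.
(* The factor [s] is 1 or -1, so one argument serves both signs of the derivative. *)
have sgn t c (s : R) : a < t < b -> is_derive t 1 (fun x => s * f x) c -> 0 < c ->
    exists N, forall n, (N <= n)%N -> s * g t < s * g (t + n.+1%:R^-1).
  move=> /andP[at_ tb] Dc c0; have [d d0 H] := is_derive_gt0_near Dc c0.
  have [N _ HN] : \forall n \near \oo, n.+1%:R^-1 < Num.min d (b - t).
    by apply: near_infty_natSinv_lt (PosNum _); rewrite lt_min d0 subr_gt0.
  exists N => n /HN /=; rewrite lt_min => /andP[nd nb].
  have n0 : 0 < n.+1%:R^-1 :> R by rewrite invr_gt0.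
  move: (n.+1%:R^-1) nd nb n0 => h nd nb n0.
  rewrite !gE; [|lra|lra].
  have := H h; rewrite gt_eqF// gtr0_norm// => /(_ isT nd).
  by rewrite pmulr_rgt0// subr_gt0.
exists dg; split.
- apply: measurable_funM; last first.
    by apply: measurable_funTS; apply: measurable_funB => //; apply: measurable_funM.
  apply: (@measurableT_comp _ _ _ _ _ _ (@Num.sqrt R)) => //.
  exact: continuous_measurable_fun (@sqrt_continuous R).
- move=> t; rewrite /dg exprMn sqr_sqrtr ?sqr_ge0// indicE.
  by case: (t \in E) => /=; rewrite ?mulr1 ?mulr0 ?sub0r ?sqrrN ?expr1n ?mulr1//; ring.
- apply: ae_impl Df => t Dt tab; have {}Dt := Dt tab.
  rewrite in_itv/= in tab.
  suff -> : dg t = df t by [].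
  rewrite /dg sqrtr_sqr indicE.
  have [dt0|dt0|->] := ltgtP (df t) 0; last by rewrite normr0 mul0r.
  + have [|N HN] := sgn t (- df t) (-1) tab _ ltac:(lra).
      by under eq_fun do rewrite mulN1r; exact: is_deriveN.
    rewrite memNset; first by rewrite ltr0_norm//=; ring.
    move=> [m _ /(_ N I)] /= gm.
    by have := HN (m + N)%N (leq_addl _ _); lra.
  + have [|N HN] := sgn t (df t) 1 tab _ dt0.
      by under eq_fun do rewrite mul1r.
    rewrite mem_set; first by rewrite gtr0_norm//=; ring.
    by exists N => // n _ /=; have := HN (N + n)%N (leq_addr _ _); rewrite !mul1r.
Qed.

End derivative_sign.

(** * From the integral inequality to the supremum of the risk *)

Lemma sqr_div_le {R : realType} (A S M : R) : 0 <= M -> 0 <= S ->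
  `|A| <= Num.sqrt M * S -> (A / S) ^+ 2 <= M.
Proof.
(* A zero denominator makes the ratio 0 by convention. *)
move=> M0 S0 AS; have [->|S_neq0] := eqVneq S 0; first by rewrite invr0 mulr0 expr0n.
have Sgt0 : 0 < S by rewrite lt_neqAle eq_sym S_neq0.
rewrite -(sqr_sqrtr M0) -[leLHS]real_normK ?num_real// lerXn2r ?nnegrE ?sqrtr_ge0//.
by rewrite normrM normfV (gtr0_norm Sgt0) ler_pdivrMr.
Qed.

(** Fubini wants a bundled sigma-finite measure; equality as measures lets it be substituted for
    [nu]. *)
Lemma sigma_finite_pack {d} {X : measurableType d} {R : realType}
    (nu : {measure set X -> \bar R}) : sigma_finite setT nu ->
  {m : {sigma_finite_measure set X -> \bar R} | m = nu :> {measure set X -> \bar R}}.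
Proof.
move=> sf; move: (sfinite_measure_sigma_finite sf).
case: nu sf => m [c1 c2] sf sfin.
pose m' : {sigma_finite_measure set X -> \bar R} := HB.pack m c1 c2
  (isSFinite.Build _ _ _ m sfin) (isSigmaFinite.Build _ _ _ m sf).
by exists m'.
Qed.

Theorem theorem2 (R : realType) (d : measure_display) (X : measurableType d)
  (nu : {measure set X -> \bar R}) (p dp : X -> R -> R) (t1 t2 : R) :
  t1 < t2 ->
  sigma_finite setT nu ->
  (* p is (jointly) measurable *)
  measurable_fun (setT `*` `[t1, t2]) (fun z : X * R => p z.1 z.2) ->
  (* p(., t) is a probability density w.r.t. nu *)
  (forall x t, t \in `[t1, t2] -> 0 <= p x t) ->
  (forall t, t \in `[t1, t2] -> (\int[nu]_x (p x t)%:E = 1)%E) ->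
  (* t |-> p(x,t) is absolutely continuous for nu-a.e. x *)
  {ae nu, forall x, abs_cont t1 t2 (p x)} ->
  (* dp is a (measurable) version of the partial derivative of p in t *)
  measurable_fun (setT `*` `[t1, t2]) (fun z : X * R => dp z.1 z.2) ->
  {ae nu, forall x, {ae lebesgue_measure, forall t,
     t \in `]t1, t2[ -> is_derive t 1 (p x) (dp x t)}} ->
  (* Fisher information finite, integrable, absolutely continuous on T *)
  (forall t, t \in `[t1, t2] -> (fisher nu p dp t < +oo)%E) ->
  (\int[lebesgue_measure]_(t in `[t1, t2]) fisher nu p dp t < +oo)%E ->
  abs_cont t1 t2 (fun t => fine (fisher nu p dp t)) ->
  forall (alpha dalpha : R -> R),
    abs_cont t1 t2 alpha ->
    (* dalpha is (a version of) the derivative alpha' *)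
    {ae lebesgue_measure, forall t,
       t \in `]t1, t2[ -> is_derive t 1 alpha (dalpha t)} ->
    abs_cont t1 t2 (fun t => dalpha t ^+ 2) ->
    alpha t1 = 0 -> alpha t2 = 0 ->
  forall that : X -> R, measurable_fun setT that ->
  (((Rintegral lebesgue_measure `[t1, t2] alpha /
     Rintegral lebesgue_measure `[t1, t2]
       (fun t => Num.sqrt (fine (fisher nu p dp t) * alpha t ^+ 2
                           + dalpha t ^+ 2))) ^+ 2)%:E
   <= ereal_sup [set (\int[nu]_x (((that x - t) ^+ 2 * p x t)%:E))%E
                 | t in `[t1, t2]])%E.
Proof.
move=> t12 sfnu mp p0 p1 acp mdp Dp fisher_fin _ acI al dal acal Dal acdal al1 al2 th mth.
have [nu' nuE] := sigma_finite_pack nu sfnu; subst nu.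
have [da [mda daE Dda]] := measurable_derivative (abs_cont_measurable acal)
  (abs_cont_measurable acdal) Dal.
have [K _ dalK] := abs_cont_bounded acdal.
set risk := [set _ | _ in _].
have risk_ge0 : (0 <= ereal_sup risk)%E.
  have t1T : t1 \in `[t1, t2] by rewrite in_itv/= lexx ltW.
  apply: le_trans (ereal_sup_ubound _); last by exists t1.
  by apply: integral_ge0 => x _; rewrite lee_fin mulr_ge0 ?sqr_ge0 ?p0.
(* An infinite risk makes the bound trivial; otherwise the supremum is a real number [M]. *)
have [supy|] := eqVneq (ereal_sup risk) +oo%E; first by rewrite supy leey.
rewrite -ltey => supy.
have riskE : ereal_sup risk = (fine (ereal_sup risk))%:E by rewrite fineK// ge0_fin_numE.
set M := fine (ereal_sup risk) in riskE.
have M0 : 0 <= M by rewrite fine_ge0.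
(* The repaired derivative: [g ^+ 2 / p] agrees with [dp ^+ 2 / p] everywhere, since division by 0
   gives 0. *)
pose g x t := if p x t == 0 then 0 else dp x t.
pose I t := fine (fisher nu' p dp t).
have gI t : t1 <= t <= t2 -> (\int[nu']_x ((g x t) ^+ 2 / p x t)%:E = (I t)%:E)%E.
  move=> tT; rewrite /I fineK.
    apply: eq_integral => x _; rewrite /g.
    by case: eqP => // ->; rewrite invr0 !mulr0.
  rewrite ge0_fin_numE; first by rewrite fisher_fin// in_itv.
  by apply: integral_ge0 => x _; rewrite lee_fin divr_ge0 ?sqr_ge0 ?p0// in_itv.
have mg : measurable_fun (setT `*` `[t1, t2]) (fun z : X * R => g z.1 z.2).
  apply: measurable_fun_if => //.
  - exact: measurableX.
  - by apply: measurable_fun_eqr.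
  - by apply: measurable_funS mdp => //; exact: measurableX.
have Dg : {ae nu', forall x, {ae lebesgue_measure, forall t,
    t \in `]t1, t2[ -> is_derive t 1 (p x) (g x t)}}.
  apply: ae_impl Dp => x; apply: ae_impl => t Dt tT; have {}Dt := Dt tT.
  rewrite /g; case: eqP => // pt0.
  rewrite in_itv/= in tT; rewrite -(is_derive_min0 tT Dt)// => s /andP[t1s st2].
  by rewrite pt0 p0// in_itv/= !ltW.
have riskM t : t1 <= t <= t2 -> (\int[nu']_x ((th x - t) ^+ 2 * p x t)%:E <= M%:E)%E.
  by move=> tT; rewrite -riskE; apply: ereal_sup_ubound; exists t => //=; rewrite in_itv.
have daK t : t1 <= t <= t2 -> `|da t| <= Num.sqrt K.
  by move=> tT; rewrite -sqrtr_sqr daE ler_wsqrtr// (le_trans (ler_norm _))// dalK.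
have := @van_Trees_bound _ _ _ nu' p g t1 t2 I al da th M (Num.sqrt K) t12 mp mg
  (fun x t tT => p0 x t ltac:(by rewrite in_itv)) _ (fun t tT => p1 t ltac:(by rewrite in_itv))
  acp Dg gI acI acal mda daK Dda al1 al2 mth riskM.
have gp x t : p x t = 0 -> g x t = 0 by rewrite /g => ->; rewrite eqxx.
move=> /(_ gp).
(* Only the square of the derivative of [al] enters the bound, so [dal] can be restored. *)
have -> : (fun t => Num.sqrt (I t * al t ^+ 2 + da t ^+ 2)) =
    (fun t => Num.sqrt (I t * al t ^+ 2 + dal t ^+ 2)).
  by apply/funext => t; rewrite daE.
move=> bound; rewrite riskE lee_fin; apply: sqr_div_le => //.
by apply: Rintegral_ge0 => t _; rewrite sqrtr_ge0.
Qed.
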